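(* Let $f:\mathbb{R}^d\to\mathbb{R}$ be twice continuously differentiable and bounded below, with gradient $g(x)=\nabla f(x)$ and Hessian $H(x)=\nabla^2 f(x)$. Assume there exists $0\le L_2<\infty$ such that for all $x\in\mathbb{R}^d$ and $t\ge0$, $\|H(x-t\,g(x))-H(x)\|\le t\,L_2\|g(x)\|$. Let $\rho\in(0,1/2)$, $\sigma>0$, $s^{\rm LPC}_{\min}\in(0,1/\sigma)$, $0<s^{\rm NC}_{\min}\le s^{\rm NC}_{\max}<\infty$. Let $x\in\mathbb{R}^d$ and let $\tilde H$ be a symmetric matrix (an inexact Hessian at $x$) with $$|\langle g(x),(H(x)-\tilde H)g(x)\rangle|\le\Delta_H\|g(x)\|^2,$$ where $\Delta_H>0$ satisfies $$\Delta_H\le2\min\left\{\sigma\left(\tfrac12-\rho\right),\ \frac{1-\rho}{s^{\rm NC}_{\max}}\right\}.$$ Let $\tilde p$ be any direction returned by the Hessian-aware scaling selection (defined in the context) with inputs $g(x)$, $\tilde H$, $\sigma$. If $$\|g(x)\|\le6\min\left\{\frac{\sigma^2\left(\frac12-\rho-\frac{\Delta_H}{2\sigma}\right)}{L_2},\ \frac{1-\rho-\frac{s^{\rm NC}_{\max}\Delta_H}{2}}{L_2\,(s^{\rm NC}_{\max})^2}\right\},$$ then the Armijo condition $f(x+\alpha\tilde p)\le f(x)+\alpha\rho\langle g(x),\tilde p\rangle$ is satisfied with $\alpha=1$.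
   Context: Vector norms are Euclidean, matrix norms are spectral. When $L_2=0$ the upper bound on $\|g(x)\|$ is read as $+\infty$. Hessian-aware scaling selection: the inputs are a vector $g\in\mathbb{R}^d$, a symmetric matrix $A\in\mathbb{R}^{d\times d}$ (the exact or inexact Hessian) and $\sigma>0$, with fixed constants $s^{\rm LPC}_{\min}\in(0,1/\sigma)$ and $0<s^{\rm NC}_{\min}\le s^{\rm NC}_{\max}<\infty$. It returns $p=-s\,g$, where: (SPC) if $\langle g,Ag\rangle>\sigma\|g\|^2$, then $s$ is any one of $s^{\rm MR}=\frac{\langle g,Ag\rangle}{\|Ag\|^2}$, $s^{\rm CG}=\frac{\|g\|^2}{\langle g,Ag\rangle}$, $s^{\rm GM}=\frac{\|g\|}{\|Ag\|}$; (LPC) if $0\le\langle g,Ag\rangle\le\sigma\|g\|^2$, then $s$ is any number in $[s^{\rm LPC}_{\min},1/\sigma]$; (NC) if $\langle g,Ag\rangle<0$, then $s$ is any number in $[s^{\rm NC}_{\min},s^{\rm NC}_{\max}]$. *)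

(* Defs.v *)
From mathcomp Require Import all_boot all_order all_algebra.
From mathcomp Require Import boolp classical_sets reals topology normedtype.
From mathcomp Require Import derive.

Set Implicit Arguments.
Unset Strict Implicit.
Unset Printing Implicit Defensive.

Import Order.TTheory GRing.Theory Num.Theory.
Import numFieldNormedType.Exports.

Local Open Scope classical_set_scope.
Local Open Scope ring_scope.

(* Vectors of R^d are column vectors. The library norm `|u| on 'cV[R]_d is    *)
(* the sup norm, so the Euclidean and spectral norms are defined here; the    *)
(* library norm is used only for the topology, on which all norms agree.      *)

Definition dot (R : realType) (d : nat) (u v : 'cV[R]_d) : R :=
  \sum_(i < d) u i 0 * v i 0.

Definition enorm (R : realType) (d : nat) (u : 'cV[R]_d) : R :=
  Num.sqrt (dot u u).

Definition specnorm (R : realType) (d : nat) (A : 'M[R]_d) : R :=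
  sup [set enorm (A *m u) | u in [set u : 'cV[R]_d | enorm u <= 1]].

Definition grad (R : realType) (d : nat) (f : 'cV[R]_d -> R) (x : 'cV[R]_d) :
    'cV[R]_d :=
  \col_(i < d) 'D_(delta_mx i 0) f x.

(* The Jacobian matrix of grad f: column j holds the derivative of the        *)
(* gradient along the j-th basis vector.                                      *)
Definition hess (R : realType) (d : nat) (f : 'cV[R]_d -> R) (x : 'cV[R]_d) :
    'M[R]_d :=
  \matrix_(i < d, j < d) 'D_(delta_mx j 0) (fun y => 'D_(delta_mx i 0) f y) x.

(* 'D_v takes a junk value where the derivative does not exist, so the        *)
(* differentiability of f and of its gradient is required explicitly.         *)
Definition twice_continuously_differentiable (R : realType) (d : nat)
    (f : 'cV[R]_d -> R) : Prop :=
  [/\ forall x, differentiable f x,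
      forall x, differentiable (grad f) x
    & continuous (hess f)].

Definition s_MR (R : realType) (d : nat) (g : 'cV[R]_d) (A : 'M[R]_d) : R :=
  dot g (A *m g) / enorm (A *m g) ^+ 2.

Definition s_CG (R : realType) (d : nat) (g : 'cV[R]_d) (A : 'M[R]_d) : R :=
  enorm g ^+ 2 / dot g (A *m g).

Definition s_GM (R : realType) (d : nat) (g : 'cV[R]_d) (A : 'M[R]_d) : R :=
  enorm g / enorm (A *m g).

(* The selection is nondeterministic: this is the set of directions it may    *)
(* return.                                                                    *)
Inductive hessian_aware_direction (R : realType) (d : nat)
    (sLPCmin sNCmin sNCmax : R) (g : 'cV[R]_d) (A : 'M[R]_d) (sigma : R) :
    'cV[R]_d -> Prop :=
| direction_SPC (s : R) :
    sigma * enorm g ^+ 2 < dot g (A *m g) ->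
    [\/ s = s_MR g A, s = s_CG g A | s = s_GM g A] ->
    hessian_aware_direction sLPCmin sNCmin sNCmax g A sigma (- (s *: g))
| direction_LPC (s : R) :
    0 <= dot g (A *m g) <= sigma * enorm g ^+ 2 ->
    sLPCmin <= s <= 1 / sigma ->
    hessian_aware_direction sLPCmin sNCmin sNCmax g A sigma (- (s *: g))
| direction_NC (s : R) :
    dot g (A *m g) < 0 ->
    sNCmin <= s <= sNCmax ->
    hessian_aware_direction sLPCmin sNCmin sNCmax g A sigma (- (s *: g)).

Definition armijo (R : realType) (d : nat) (f : 'cV[R]_d -> R) (rho : R)
    (x p : 'cV[R]_d) (alpha : R) : Prop :=
  f (x + alpha *: p) <= f x + alpha * rho * dot (grad f x) p.

(* Main.v *)
Require Import Defs.
From mathcomp Require Import all_boot all_order all_algebra.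
From mathcomp Require Import boolp classical_sets reals topology normedtype.
From mathcomp Require Import functions.
From mathcomp Require Import derive.
From mathcomp Require Import ring lra.

Set Implicit Arguments.
Unset Strict Implicit.
Unset Printing Implicit Defensive.

Import Order.TTheory GRing.Theory Num.Theory.
Import numFieldNormedType.Exports.

Local Open Scope classical_set_scope.
Local Open Scope ring_scope.

(** Restrict f to the ray s |-> x - s g with g = grad f x. Its slope at s = 0
    is - |g|^2, and by the Lipschitz condition on the Hessian its second
    derivative at s is at most <g, H g> + s L2 |g|^3, so integrating twice
    gives ([cubic_descent])
      f (x - s g) <= f x - s |g|^2 + s^2 <g, H g> / 2 + s^3 L2 |g|^3 / 6.
    Exchanging H for the inexact Hessian Ht costs at most s^2 DeltaH |g|^2 / 2.
    If moreover s <g, Ht g> <= 2 (1 - m) |g|^2, then the Armijo condition with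
    unit step follows from s |g|^2 times the scalar inequality
    ([armijo_of_curvature])
      rho + s DeltaH / 2 + s^2 L2 |g| / 6 <= m.

    Two values of m cover the three cases. Under negative curvature m = 1. In
    the other two cases m = 1/2, because s <g, Ht g> <= |g|^2: for small
    curvature this follows from s <= 1 / sigma, and for strong curvature the
    Cauchy-Schwarz inequality orders the three scalings as
    s_MR <= s_GM <= s_CG, while s_CG <g, Ht g> = |g|^2 ([SPC_step]). The left
    side of the scalar inequality increases with s, so it suffices to check it
    at the largest admissible s, which is 1 / sigma or sNCmax ([budget_le]);
    there it is the assumed bound on |g|, or on DeltaH if L2 = 0. *)

(** * Euclidean and spectral norms *)

Lemma dotC (R : realType) (d : nat) (u v : 'cV[R]_d) : dot u v = dot v u.
Proof. by apply: eq_bigr => i _; rewrite mulrC. Qed.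

Lemma dotDr (R : realType) (d : nat) (u v w : 'cV[R]_d) :
  dot u (v + w) = dot u v + dot u w.
Proof. by rewrite /dot -big_split; apply: eq_bigr => i _; rewrite mxE mulrDr. Qed.

Lemma dotZr (R : realType) (d : nat) (a : R) (u v : 'cV[R]_d) :
  dot u (a *: v) = a * dot u v.
Proof.
by rewrite /dot mulr_sumr; apply: eq_bigr => i _; rewrite mxE mulrCA.
Qed.

Lemma dotNr (R : realType) (d : nat) (u v : 'cV[R]_d) :
  dot u (- v) = - dot u v.
Proof. by rewrite -scaleN1r dotZr mulN1r. Qed.

Lemma dotBr (R : realType) (d : nat) (u v w : 'cV[R]_d) :
  dot u (v - w) = dot u v - dot u w.
Proof. by rewrite dotDr dotNr. Qed.

Lemma dot_ge0 (R : realType) (d : nat) (u : 'cV[R]_d) : 0 <= dot u u.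
Proof. by apply: sumr_ge0 => i _; rewrite -expr2 sqr_ge0. Qed.

Lemma enorm_ge0 (R : realType) (d : nat) (u : 'cV[R]_d) : 0 <= enorm u.
Proof. exact: sqrtr_ge0. Qed.

Lemma sqr_enorm (R : realType) (d : nat) (u : 'cV[R]_d) :
  enorm u ^+ 2 = dot u u.
Proof. by rewrite sqr_sqrtr ?dot_ge0. Qed.

Lemma enormZ (R : realType) (d : nat) (a : R) (u : 'cV[R]_d) :
  enorm (a *: u) = `|a| * enorm u.
Proof.
rewrite /enorm dotZr dotC dotZr mulrA -expr2.
by rewrite sqrtrM ?sqr_ge0 // sqrtr_sqr.
Qed.

(** Lagrange's identity: the defect of the inequality is half of the sum of
    the squares of all minors u_i v_j - u_j v_i. *)
Lemma dot_sqr_le (R : realType) (d : nat) (u v : 'cV[R]_d) :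
  dot u v ^+ 2 <= dot u u * dot v v.
Proof.
have lagrange :
    \sum_i \sum_j (u i 0 * v j 0 - u j 0 * v i 0) ^+ 2
      = 2 * (dot u u * dot v v - dot u v ^+ 2).
  have prodE (a b : 'I_d -> R) :
      (\sum_i a i) * (\sum_j b j) = \sum_i \sum_j a i * b j.
    by rewrite mulr_suml; apply: eq_bigr => i _; rewrite mulr_sumr.
  have -> : 2 * (dot u u * dot v v - dot u v ^+ 2)
      = dot u u * dot v v + dot v v * dot u u
        + (- 2) * (dot u v * dot u v) by ring.
  rewrite /dot !prodE mulr_sumr -!big_split; apply: eq_bigr => i _ /=.
  rewrite mulr_sumr.
  rewrite -!big_split; apply: eq_bigr => j _ /=; ring.
rewrite -subr_ge0 -(pmulr_rge0 _ (ltr0Sn R 1)) -lagrange.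
by apply: sumr_ge0 => i _; apply: sumr_ge0 => j _; rewrite sqr_ge0.
Qed.

Lemma norm_dot_le (R : realType) (d : nat) (u v : 'cV[R]_d) :
  `|dot u v| <= enorm u * enorm v.
Proof.
rewrite -ler_sqr ?nnegrE ?mulr_ge0 ?enorm_ge0 //.
by rewrite real_normK ?num_real // exprMn !sqr_enorm dot_sqr_le.
Qed.

(** The Frobenius norm dominates the operator norm, by the Cauchy-Schwarz
    inequality for each row; this is what makes the set whose supremum
    defines [specnorm] bounded. *)
Lemma enorm_mulmx_bounded (R : realType) (d : nat) (A : 'M[R]_d) :
  exists2 C, 0 <= C & forall u, enorm (A *m u) <= C * enorm u.
Proof.
pose F := \sum_i dot (row i A)^T (row i A)^T.
have F0 : 0 <= F by apply: sumr_ge0 => i _; exact: dot_ge0.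
exists (Num.sqrt F) => [|u]; first exact: sqrtr_ge0.
rewrite /enorm -sqrtrM // ler_wsqrtr //= /F mulr_suml; apply: ler_sum => i _.
have -> : (A *m u) i 0 = dot (row i A)^T u.
  by rewrite mxE; apply: eq_bigr => j _; rewrite !mxE.
by rewrite -expr2 dot_sqr_le.
Qed.

Lemma enorm_mulmx_le (R : realType) (d : nat) (A : 'M[R]_d) (u : 'cV[R]_d) :
  enorm (A *m u) <= specnorm A * enorm u.
Proof.
have [C C0 AC] := enorm_mulmx_bounded A.
have [u0|un0] := eqVneq (enorm u) 0.
  by have := AC u; rewrite u0 !mulr0.
have u_gt0 : 0 < enorm u by rewrite lt_def un0 enorm_ge0.
rewrite -ler_pdivrMr //; apply: ub_le_sup.
  by exists C => _ [v /= v1 <-]; rewrite (le_trans (AC v)) // ler_piMr.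
exists ((enorm u)^-1 *: u) => /=.
  by rewrite enormZ ger0_norm ?invr_ge0 ?enorm_ge0 // mulVf.
by rewrite -scalemxAr enormZ ger0_norm ?invr_ge0 ?enorm_ge0 // mulrC.
Qed.

Lemma quadratic_form_le (R : realType) (d : nat) (A : 'M[R]_d) (u : 'cV[R]_d) :
  dot u (A *m u) <= specnorm A * enorm u ^+ 2.
Proof.
apply: le_trans (ler_norm _) _; apply: le_trans (norm_dot_le _ _) _.
by rewrite expr2 mulrCA ler_wpM2l ?enorm_ge0 ?enorm_mulmx_le.
Qed.

(** * Derivatives along a line *)

Lemma derive_basis (R : realType) (d : nat) (F : 'cV[R]_d -> R)
    (y v : 'cV[R]_d) :
  differentiable F y -> 'D_v F y = \sum_i v i 0 * 'D_(delta_mx i 0) F y.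
Proof.
move=> dF; rewrite deriveE // {1}[v]matrix_sum_delta linear_sum.
apply: eq_bigr => i _; rewrite big_ord1 linearZ /= deriveE //.
Qed.

(** The difference quotients of the restriction at t are those of F at
    y + t v in the direction v. *)
Lemma is_derive_line (R : realType) (d : nat) (F : 'cV[R]_d -> R)
    (y v : 'cV[R]_d) (t : R) :
  differentiable F (y + t *: v) ->
  is_derive t 1 (fun s => F (y + s *: v)) ('D_v F (y + t *: v)).
Proof.
move=> dF.
have quotE : (fun h : R => h^-1 *: (((fun s => F (y + s *: v)) \o shift t)
      (h *: 1) - F (y + t *: v)))
    = (fun h : R => h^-1 *: ((F \o shift (y + t *: v)) (h *: v)
      - F (y + t *: v))).
  apply/funext => h /=; congr (_ *: (F _ - _)).
  by rewrite [h *: 1]mulr1 scalerDl addrCA.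
split; first by rewrite /derivable quotE; exact: diff_derivable.
by rewrite /derive quotE.
Qed.

Lemma hess_coefE (R : realType) (d : nat) (f : 'cV[R]_d -> R) (y : 'cV[R]_d)
    (i j : 'I_d) :
  hess f y i j = 'D_(delta_mx j 0) (fun z => grad f z i 0) y.
Proof.
rewrite mxE; congr (derive _ _ _).
by apply/funext => z; rewrite mxE.
Qed.

Lemma differentiable_grad_coef (R : realType) (d : nat) (f : 'cV[R]_d -> R)
    (y : 'cV[R]_d) (i : 'I_d) :
  differentiable (grad f) y -> differentiable (fun z => grad f z i 0) y.
Proof.
move=> dg.
apply: (@differentiable_comp _ _ _ _ (grad f) (fun M : 'cV[R]_d => M i 0)) => //.
exact: differentiable_coord.
Qed.

Lemma is_derive_along_line (R : realType) (d : nat) (f : 'cV[R]_d -> R)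
    (y v : 'cV[R]_d) (t : R) :
  differentiable f (y + t *: v) ->
  is_derive t 1 (fun s => f (y + s *: v)) (dot (grad f (y + t *: v)) v).
Proof.
move=> df; apply: (is_derive_eq (is_derive_line df)).
by rewrite derive_basis //; apply: eq_bigr => i _; rewrite mxE mulrC.
Qed.

(** Row i of [hess f] lists the derivatives of the i-th partial derivative of f
    along the basis vectors, so its product with v is the derivative of that
    partial derivative along v. *)
Lemma is_derive_grad_along_line (R : realType) (d : nat) (f : 'cV[R]_d -> R)
    (y v : 'cV[R]_d) (t : R) :
  differentiable (grad f) (y + t *: v) ->
  is_derive t 1 (fun s => dot (grad f (y + s *: v)) v)
    (dot v (hess f (y + t *: v) *m v)).
Proof.
move=> dg.
have -> : (fun s => dot (grad f (y + s *: v)) v)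
    = \sum_i (v i 0 \*: (fun s => grad f (y + s *: v) i 0) : R -> R^o).
  by apply/funext => s; rewrite fct_sumE; apply: eq_bigr => i _; exact: mulrC.
apply: is_derive_eq.
  apply: is_derive_sum => i; apply: is_deriveZ.
  exact/(is_derive_line (F := fun z => grad f z i 0))/differentiable_grad_coef.
apply: eq_bigr => i _; rewrite mxE; congr (_ * _).
rewrite derive_basis; last exact: differentiable_grad_coef.
by apply: eq_bigr => j _; rewrite hess_coefE mulrC.
Qed.

(** * A cubic upper bound on the ray of steepest descent *)

Lemma derivative_le0_le (R : realType) (h h' : R -> R) (s : R) :
  (forall t : R, is_derive t 1 h (h' t)) -> (forall t, 0 <= t -> h' t <= 0) ->
  0 <= s -> h s <= h 0.
Proof.
move=> dh h'0; rewrite le_eqVlt => /predU1P[<-//|s0].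
have ch : {within `[0, s], continuous h}.
  apply: continuous_subspaceT => t; apply: differentiable_continuous.
  by apply/derivable1_diffP; case: (dh t).
have [t t0s hE] := MVT s0 (fun t _ => dh t) ch.
rewrite -subr_le0 hE subr0 mulr_le0_ge0 // ?(ltW s0) //.
by apply: h'0; move: t0s; rewrite in_itv /= => /andP[/ltW].
Qed.

(** Integrating h'' t <= a + b t twice. In place of an integral, the difference
    between each side and its antiderivative is shown to be nonincreasing, first
    for h' and then for h. *)
Lemma cubic_taylor_bound (R : realType) (h h' h'' : R -> R) (a b s : R) :
  (forall t : R, is_derive t 1 h (h' t)) ->
  (forall t : R, is_derive t 1 h' (h'' t)) ->
  (forall t, 0 <= t -> h'' t <= a + b * t) ->
  0 <= s ->
  h s <= h 0 + h' 0 * s + a / 2 * s ^+ 2 + b / 6 * s ^+ 3.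
Proof.
move=> dh dh' h''le s0.
have h'le t : 0 <= t -> h' t <= h' 0 + a * t + b / 2 * t ^+ 2.
  move=> t0.
  have D (u : R) : is_derive u 1 (fun t => h' t - (a * t + b / 2 * t ^+ 2))
      (h'' u - (a + b * u)).
    apply: is_derive_eq; rewrite /GRing.scale /=; lra.
  have := derivative_le0_le D _ t0.
  have + : forall u, 0 <= u -> h'' u - (a + b * u) <= 0.
    by move=> u /h''le; rewrite subr_le0.
  by move=> /[swap] /[apply]; lra.
have D (u : R) : is_derive u 1
    (fun t => h t - (h' 0 * t + a / 2 * t ^+ 2 + b / 6 * t ^+ 3))
    (h' u - (h' 0 + a * u + b / 2 * u ^+ 2)).
  apply: is_derive_eq; rewrite /GRing.scale /=; lra.
have := derivative_le0_le D _ s0.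
have + : forall u, 0 <= u -> h' u - (h' 0 + a * u + b / 2 * u ^+ 2) <= 0.
  by move=> u /h'le; rewrite subr_le0.
by move=> /[swap] /[apply]; lra.
Qed.

(** The second derivative of f along the ray is <g, H (x - t g) g>. It exceeds
    <g, H g> by the quadratic form of a matrix of spectral norm at most t L |g|,
    evaluated at g, hence by at most t L |g|^3. *)
Lemma cubic_descent (R : realType) (d : nat) (f : 'cV[R]_d -> R)
    (x : 'cV[R]_d) (L s : R) :
  (forall y, differentiable f y) -> (forall y, differentiable (grad f) y) ->
  (forall t, 0 <= t ->
     specnorm (hess f (x - t *: grad f x) - hess f x)
       <= t * L * enorm (grad f x)) ->
  0 <= s ->
  f (x - s *: grad f x)
    <= f x - enorm (grad f x) ^+ 2 * s
       + dot (grad f x) (hess f x *m grad f x) / 2 * s ^+ 2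
       + L * enorm (grad f x) ^+ 3 / 6 * s ^+ 3.
Proof.
move=> df dg lip s0; set g := grad f x in lip *.
have quadN (A : 'M[R]_d) : dot (- g) (A *m - g) = dot g (A *m g).
  by rewrite mulmxN dotNr dotC dotNr opprK dotC.
have quad_le (t : R) : 0 <= t ->
    dot (- g) (hess f (x + t *: - g) *m - g)
      <= dot g (hess f x *m g) + L * enorm g ^+ 3 * t.
  move=> t0; rewrite quadN scalerN -lerBlDl -dotBr -mulmxBl.
  apply: le_trans (quadratic_form_le _ _) _.
  have := ler_wpM2r (sqr_ge0 (enorm g)) (lip t t0); lra.
have := @cubic_taylor_bound R (fun s => f (x + s *: - g)) _ _ _ _ s
  (fun t => is_derive_along_line (df (x + t *: - g)))
  (fun t => is_derive_grad_along_line (dg (x + t *: - g))) quad_le s0.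
by rewrite /= scale0r addr0 scalerN dotNr -/g -sqr_enorm mulNr.
Qed.

(** * Sufficient decrease *)

(** [m] is the fraction of the linear decrease s |g|^2 that survives the inexact
    quadratic term: 1/2 for positive curvature, 1 for negative curvature. The
    error of the Hessian and the cubic term have to fit into m - rho. *)
Lemma armijo_of_curvature (R : realType) (d : nat) (f : 'cV[R]_d -> R)
    (x : 'cV[R]_d) (Ht : 'M[R]_d) (L Delta rho m s : R) :
  (forall y, differentiable f y) -> (forall y, differentiable (grad f) y) ->
  (forall t, 0 <= t ->
     specnorm (hess f (x - t *: grad f x) - hess f x)
       <= t * L * enorm (grad f x)) ->
  `|dot (grad f x) ((hess f x - Ht) *m grad f x)|
     <= Delta * enorm (grad f x) ^+ 2 ->
  0 <= s ->
  s * dot (grad f x) (Ht *m grad f x) <= 2 * (1 - m) * enorm (grad f x) ^+ 2 ->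
  rho + s * Delta / 2 + s ^+ 2 * L * enorm (grad f x) / 6 <= m ->
  armijo f rho x (- (s *: grad f x)) 1.
Proof.
move=> df dg lip err s0 curv budget.
rewrite /armijo scale1r mul1r dotNr dotZr -sqr_enorm.
apply: le_trans (cubic_descent df dg lip s0) _.
move/ler_normlP: err => [_]; rewrite mulmxBl dotBr => err.
have n0 := enorm_ge0 (grad f x).
move: (dot _ (Ht *m _)) (dot _ (hess f x *m _)) err curv => qt q err curv.
(* The claim is half of the first two inequalities plus the third: the first
   exchanges the Hessian for Ht, the second bounds the term in Ht, and the third
   is the budget scaled by s |g|^2. *)
have e1 := ler_wpM2l (sqr_ge0 s) err.
have e2 := ler_wpM2l s0 curv.
have e3 := ler_wpM2l (mulr_ge0 s0 (sqr_ge0 (enorm (grad f x)))) budget.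
lra.
Qed.

(** With q = <g, A g>, n = |g| and k = |A g|, Cauchy-Schwarz reads q <= n k and
    gives q / k^2 <= n / k <= n^2 / q. So every scaling is at most s_CG, whose
    product with q is n^2 and which is below 1 / sigma by the curvature
    condition. *)
Lemma SPC_step (R : realType) (d : nat) (g : 'cV[R]_d) (A : 'M[R]_d)
    (sigma s : R) :
  0 < sigma -> sigma * enorm g ^+ 2 < dot g (A *m g) ->
  [\/ s = s_MR g A, s = s_CG g A | s = s_GM g A] ->
  [/\ 0 <= s, s <= 1 / sigma & s * dot g (A *m g) <= enorm g ^+ 2].
Proof.
move=> sigma0 spc.
have cs := norm_dot_le g (A *m g).
have n0 := enorm_ge0 g; have k0 := enorm_ge0 (A *m g).
rewrite /s_MR /s_CG /s_GM.
move: (dot _ _) (enorm g) (enorm (A *m g)) spc cs n0 k0 => q n k spc cs n0 k0.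
have q0 : 0 < q by apply: le_lt_trans spc; rewrite mulr_ge0 ?sqr_ge0 ?ltW.
rewrite gtr0_norm // in cs.
have k_gt0 : 0 < k.
  rewrite lt_def k0 andbT; apply: contraTneq cs => ->.
  by rewrite mulr0 -ltNge.
have CG_le : n ^+ 2 / q <= 1 / sigma.
  by rewrite ler_pdivrMr // mul1r ler_pdivlMl // ltW.
have GM_le : n / k <= n ^+ 2 / q.
  rewrite ler_pdivrMr // mulrAC ler_pdivlMr // expr2 -mulrA.
  by rewrite ler_wpM2l.
have MR_le : q / k ^+ 2 <= n / k.
  rewrite ler_pdivrMr ?exprn_gt0 // expr2 mulrA divfK ?gt_eqF //.
suff below_CG : 0 <= s -> s <= n ^+ 2 / q ->
    [/\ 0 <= s, s <= 1 / sigma & s * q <= n ^+ 2].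
  case=> sE; apply: below_CG; rewrite sE ?divr_ge0 ?sqr_ge0 ?(ltW q0) //.
  exact: le_trans GM_le.
move=> s0 sCG; split => //; first exact: le_trans CG_le.
by rewrite -ler_pdivlMr.
Qed.

(** The left side is monotone in [s], so the value at the largest scaling [S]
    decides. When L = 0 only the error of the Hessian remains. *)
Lemma budget_le (R : realType) (L Delta rho n m S s : R) :
  0 <= L -> 0 <= Delta -> 0 <= n -> 0 <= s <= S ->
  S * Delta / 2 <= m - rho ->
  (L != 0 -> n <= 6 * ((m - rho - S * Delta / 2) / (L * S ^+ 2))) ->
  0 < S ->
  rho + s * Delta / 2 + s ^+ 2 * L * n / 6 <= m.
Proof.
move=> L0 Delta0 n0 /andP[s0 sS] errS gradS S0.
have LnS : S ^+ 2 * L * n / 6 <= m - rho - S * Delta / 2.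
  have [->|Ln0] := eqVneq L 0; first by lra.
  have LS0 : 0 < L * S ^+ 2 by rewrite mulr_gt0 ?exprn_gt0 // lt_def Ln0.
  have := gradS Ln0; rewrite -ler_pdivrMl // ler_pdivlMr //; lra.
have e1 := ler_wpM2r Delta0 sS.
have e2 : s ^+ 2 * (L * n) <= S ^+ 2 * (L * n).
  by rewrite ler_wpM2r ?mulr_ge0 // ler_sqr ?nnegrE // (le_trans s0).
lra.
Qed.

(** * The unit step satisfies the Armijo condition *)

(* The condition L2 != 0 in hgrad renders the reading of the upper bound on   *)
(* the gradient norm as +oo when L2 = 0.                                      *)
Theorem propositionB13 (R : realType) (d : nat) (f : 'cV[R]_d -> R)
    (hf : twice_continuously_differentiable f)
    (hbelow : has_lbound (range f))
    (L2 : R) (hL2 : 0 <= L2)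
    (hlip : forall (x : 'cV[R]_d) (t : R), 0 <= t ->
       specnorm (hess f (x - t *: grad f x) - hess f x)
         <= t * L2 * enorm (grad f x))
    (rho sigma sLPCmin sNCmin sNCmax : R)
    (hrho : 0 < rho < 1 / 2)
    (hsigma : 0 < sigma)
    (hLPC : 0 < sLPCmin < 1 / sigma)
    (hNCmin : 0 < sNCmin) (hNC : sNCmin <= sNCmax)
    (x : 'cV[R]_d) (Ht : 'M[R]_d) (hsym : Ht \is symmetricmx)
    (DeltaH : R) (hDelta : 0 < DeltaH)
    (hHt : `| dot (grad f x) ((hess f x - Ht) *m grad f x) |
             <= DeltaH * enorm (grad f x) ^+ 2)
    (hDeltaH : DeltaH <= 2 * Num.min (sigma * (1 / 2 - rho))
                                     ((1 - rho) / sNCmax))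
    (p : 'cV[R]_d)
    (hp : hessian_aware_direction sLPCmin sNCmin sNCmax (grad f x) Ht sigma p)
    (hgrad : L2 != 0 ->
       enorm (grad f x) <=
         6 * Num.min
           (sigma ^+ 2 * (1 / 2 - rho - DeltaH / (2 * sigma)) / L2)
           ((1 - rho - sNCmax * DeltaH / 2) / (L2 * sNCmax ^+ 2))) :
  armijo f rho x p 1.
Proof.
case: hf => df dg _.
have g0 := enorm_ge0 (grad f x).
have [_ rho_lt] := andP hrho.
have NCmax0 : 0 < sNCmax by exact: lt_le_trans hNC.
have sigmaV0 : 0 < 1 / sigma by rewrite divr_gt0.
have [errPC errNC] : 1 / sigma * DeltaH / 2 <= 1 / 2 - rho
    /\ sNCmax * DeltaH / 2 <= 1 - rho.
  move: hDeltaH; rewrite -ler_pdivrMl // le_min => /andP[ePC eNC].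
  split.
    by rewrite mul1r -mulrA ler_pdivrMl // mulrC.
  by move: eNC; rewrite ler_pdivlMr //; lra.
have PC (s : R) : 0 <= s -> s <= 1 / sigma ->
    s * dot (grad f x) (Ht *m grad f x) <= enorm (grad f x) ^+ 2 ->
    armijo f rho x (- (s *: grad f x)) 1.
  move=> s0 s_le curv.
  apply: (armijo_of_curvature (Ht := Ht) (m := 1 / 2) df dg (hlip x) hHt) => //.
    by lra.
  apply: (budget_le (S := 1 / sigma)); rewrite ?s0 ?(ltW hDelta) //.
  move=> L2n0; apply: le_trans (hgrad L2n0) _.
  rewrite ler_pM2l // ge_min; apply/orP; left.
  rewrite le_eqVlt; apply/orP; left; apply/eqP; field.
  by rewrite L2n0 gt_eqF.
case: p / hp => s.
- move=> spc sE; have [s0 s_le curv] := SPC_step hsigma spc sE.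
  exact: PC.
- move=> /andP[q0 q_le] /andP[s_ge s_le].
  have s0 : 0 <= s by rewrite (le_trans _ s_ge) // ltW //; case/andP: hLPC.
  apply: PC => //; apply: le_trans (ler_wpM2l s0 q_le) _.
  rewrite mulrA ler_piMl ?sqr_ge0 // -ler_pdivlMr //.
- move=> q_lt0 /andP[s_ge s_le].
  have s0 : 0 <= s by rewrite (le_trans _ s_ge) // ltW.
  apply: (armijo_of_curvature (Ht := Ht) (m := 1) df dg (hlip x) hHt) => //.
    by rewrite subrr mulr0 mul0r mulr_ge0_le0 // ltW.
  apply: (budget_le (S := sNCmax)); rewrite ?s0 ?(ltW hDelta) //.
  move=> /hgrad /le_trans; apply; rewrite ler_pM2l // ge_min lexx orbT //.
Qed.
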